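(* The probability that a randomly assembled Rubik's Revenge is solvable is $\frac{1}{2^{12}\cdot 3}$. That is, if $s$ is chosen uniformly at random from $\mathcal{S}_{Conf}$, then the probability that there exists $g\in\mathbf{G}$ such that in the configuration $g\cdot s$ every face of the cube shows a single colour equals $\frac{1}{2^{12}\cdot 3}$.
   Context: Geometry. The Rubik's Revenge is the $4\times4\times4$ cube. Its $56$ visible cubies occupy the positions $p\in\{-3,-1,1,3\}^3$ having at least one coordinate equal to $\pm3$: $8$ corner positions (three coordinates $\pm3$), $24$ edge positions (exactly two), $24$ center positions (exactly one). A facelet is a pair $(p,n)$ with $p$ a position and $n\in\{\pm e_1,\pm e_2,\pm e_3\}$ an outward unit normal with $p\cdot n=3$; there are $96$ facelets. The faces right, left, back, front, up, down have normals $e_1,-e_1,e_2,-e_2,e_3,-e_3$, and in the solved cube they are coloured blue, green, orange, red, white, yellow respectively. Each sticker is identified with the facelet it occupies in the solved cube, its home facelet, and its colour is the colour of the face containing its home facelet. Moves. The group of moves $\mathbf{M}$ is generated by the twelve clockwise quarter turns $R,L,F,B,U,D$ (external slices) and $C_R,C_L,C_F,C_B,C_U,C_D$ (central slices). The external turn of the face with normal $n$ applies to all facelets $(p,m)$ with $p\cdot n=3$ the rotation by $90^\circ$ about $n$, clockwise when viewed from outside that face (acting on both $p$ and $m$), and fixes the other facelets. The corresponding central turn does the same to all facelets with $p\cdot n=1$. $\mathbf{G}\subset\mathbf{S}_{96}$ is the group of permutations of the $96$ facelets generated by these moves. Configurations. $\mathcal{S}_{Conf}\subset \mathbf{S}_{96}$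 is the set of all permutations and/or orientation changes of corner, edge and center cubies: permutations $s$ of the facelets ($s(f)$ being the facelet currently occupied by the sticker with home $f$) such that, for each position $p$, $s$ maps the facelets of $p$ onto the facelets of a position $p'$ of the same kind (corner, edge or center), and for corners respects the clockwise cyclic order of the three facelets. All such $s$ are allowed, including flips of a single edge cubie, so $|\mathcal{S}_{Conf}|=(24!)^2\cdot2^{24}\cdot3^8\cdot8!$. $\mathbf{G}$ acts on $\mathcal{S}_{Conf}$ on the left by composition, $g\cdot s=g\circ s$. A randomly assembled Rubik's Revenge is a pattern obtained from the solved Revenge by any permutation and/or orientation change (edge flips included) of corner, edge and center cubies. The cubies carry no labels besides the colours: center cubies of the same colour are indistinguishable, as are the two edge cubies with the same pair of colours. Thus a pattern is solvable if moves can bring it to a state in which every face shows a single colour. *)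

(* Defs.v *)
From HB Require Import structures.
From mathcomp Require Import all_boot all_order all_algebra all_fingroup.

Set Implicit Arguments.
Unset Strict Implicit.
Unset Printing Implicit Defensive.

Import GRing.Theory.
Local Open Scope ring_scope.

(* Integer vectors are triples rather than ['rV[int]_3], so that every
   geometric predicate below evaluates by computation. *)
Definition vec : Type := (int * int * int)%type.

Definition dot (u v : vec) : int :=
  let: (u1, u2, u3) := u in let: (v1, v2, v3) := v in
  u1 * v1 + u2 * v2 + u3 * v3.

Definition cross (u v : vec) : vec :=
  let: (u1, u2, u3) := u in let: (v1, v2, v3) := v in
  (u2 * v3 - u3 * v2, u3 * v1 - u1 * v3, u1 * v2 - u2 * v1).

Definition scalev (a : int) (u : vec) : vec :=
  let: (u1, u2, u3) := u in (a * u1, a * u2, a * u3).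

Definition subv (u v : vec) : vec :=
  let: (u1, u2, u3) := u in let: (v1, v2, v3) := v in
  (u1 - v1, u2 - v2, u3 - v3).

Definition oppv (u : vec) : vec := scalev (-1) u.

Definition e1 : vec := (1, 0, 0).
Definition e2 : vec := (0, 1, 0).
Definition e3 : vec := (0, 0, 1).

Inductive face := Right | Left | Back | Front | Up | Down.

Definition faces : seq face := [:: Right; Left; Back; Front; Up; Down].

Definition outward (F : face) : vec :=
  match F with
  | Right => e1 | Left => oppv e1
  | Back => e2 | Front => oppv e2
  | Up => e3 | Down => oppv e3
  end.

Inductive colour := Blue | Green | Orange | Red | White | Yellow.

Definition colour_eq_dec (c c' : colour) : {c = c'} + {c <> c'}.
Proof. by decide equality. Defined.

HB.instance Definition _ := hasDecEq.Build colour (compareP colour_eq_dec).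

Definition coordinates : seq int := [:: -3%:Z; -1%:Z; 1%:Z; 3%:Z].

(* The number of coordinates equal to 3 or -3: 3 for a corner, 2 for an edge,
   1 for a center, 0 for an interior (invisible) position. *)
Definition kind (p : vec) : nat :=
  let: (p1, p2, p3) := p in
  count (fun x : int => (x == 3) || (x == -3)) [:: p1; p2; p3].

Definition positions : seq vec :=
  [seq p <- [seq (xy, z) | xy <- [seq (x, y) | x <- coordinates,
                                              y <- coordinates],
                          z <- coordinates] | (0 < kind p)%N].

Definition facelet_seq : seq (vec * vec) :=
  [seq f <- [seq (p, n) | p <- positions, n <- map outward faces]
     | dot f.1 f.2 == 3].

Definition facelet : finType := seq_sub facelet_seq.

Definition fpos (f : facelet) : vec := (ssval f).1.
Definition fnormal (f : facelet) : vec := (ssval f).2.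

Lemma card_facelet : #|facelet| = 96%N.
Proof. by rewrite card_seq_sub; vm_compute. Qed.

(* Rotation by 90 degrees about the unit vector [n], clockwise for an observer
   towards whom [n] points: Rodrigues' formula with angle -pi/2. *)
Definition rotate (n v : vec) : vec := subv (scalev (dot n v) n) (cross n v).

Inductive slice := External | Central.

Definition slices : seq slice := [:: External; Central].

Definition depth (k : slice) : int :=
  match k with External => 3 | Central => 1 end.

Definition turn_pair (F : face) (k : slice) (f : vec * vec) : vec * vec :=
  if dot f.1 (outward F) == depth k
  then (rotate (outward F) f.1, rotate (outward F) f.2) else f.

Lemma turn_pair_facelet F k f :
  f \in facelet_seq -> turn_pair F k f \in facelet_seq.
Proof.
have /allP : all (fun f => turn_pair F k f \in facelet_seq) facelet_seq.
  by case: F; case: k; vm_compute.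
exact.
Qed.

Definition turn_fun (F : face) (k : slice) (f : facelet) : facelet :=
  SeqSub (turn_pair_facelet F k (ssvalP f)).

Lemma turn_fun_inj F k : injective (turn_fun F k).
Proof.
have /allP turn4 : all (fun f => iter 4 (turn_pair F k) f == f) facelet_seq.
  by case: F; case: k; vm_compute.
move=> f g eq_fg; apply: val_inj => /=.
rewrite -(eqP (turn4 _ (ssvalP f))) -(eqP (turn4 _ (ssvalP g))).
by rewrite !(iterSr 3) (congr1 val eq_fg : turn_pair F k _ = turn_pair F k _).
Qed.

Definition turn (F : face) (k : slice) : {perm facelet} :=
  perm (@turn_fun_inj F k).

Definition quarter_turns : seq {perm facelet} :=
  [seq turn F k | F <- faces, k <- slices].

Definition cube_group : {group {perm facelet}} :=
  <<[set g in quarter_turns]>>%G.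

Definition facelets_at (p : vec) : {set facelet} := [set f | fpos f == p].

(* The determinant of three normals at one position is nonzero only when they
   are the three normals of a corner; going around them clockwise, as seen from
   outside the cube, then makes a left-handed triple. *)
Definition clockwise (f f' f'' : facelet) : bool :=
  [&& fpos f == fpos f', fpos f' == fpos f''
    & dot (cross (fnormal f) (fnormal f')) (fnormal f'') == -1].

(* [s f] is the facelet occupied by the sticker whose home is [f]. *)
Definition is_conf (s : {perm facelet}) : bool :=
  all (fun p => has (fun p' => (kind p' == kind p)
                               && (s @: facelets_at p == facelets_at p'))
                    positions) positions
  && [forall f, forall f', forall f'',
        clockwise f f' f'' ==> clockwise (s f) (s f') (s f'')].

Definition SConf : {set {perm facelet}} := [set s | is_conf s].

(* [(g \o s) f = g (s f)]: products in [{perm facelet}] apply the left factor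
   first. *)
Definition conf_act (g s : {perm facelet}) : {perm facelet} := (s * g)%g.

Definition face_colour (F : face) : colour :=
  match F with
  | Right => Blue | Left => Green
  | Back => Orange | Front => Red
  | Up => White | Down => Yellow
  end.

(* The face containing a facelet is the one with the same normal. *)
Definition face_of (f : facelet) : face :=
  nth Right faces (index (fnormal f) (map outward faces)).

Definition sticker_colour (f : facelet) : colour := face_colour (face_of f).

(* The colour seen at the place [f]. *)
Definition shown_colour (s : {perm facelet}) (f : facelet) : colour :=
  sticker_colour ((s^-1)%g f).

Definition monochromatic_faces (s : {perm facelet}) : bool :=
  [forall f, forall f',
     (fnormal f == fnormal f') ==> (shown_colour s f == shown_colour s f')].

Definition solvable_conf (s : {perm facelet}) : bool :=
  [exists g in cube_group, monochromatic_faces (conf_act g s)].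

Definition uniform_prob (T : finType) (A : {set T}) (P : pred T) : rat :=
  #|[set x in A | P x]|%:R / #|A|%:R.

(* Main.v *)
(* A configuration is solvable exactly when two kinds of invariants of the cube
   group vanish: the total corner twist modulo 3, and, for each of the twelve
   pairs of equally coloured edge cubies, the sum modulo 2 of their flips.  Here
   flips are measured by a chirality of edge facelets which every move preserves,
   and the two cubies of a pair have opposite chirality, so exchanging them flips
   both.  In a configuration with monochromatic faces the stickers are moved by a
   permutation of the six normals, which forces both invariants to vanish.
   Conversely, moves generate enough elements to bring home first the corners
   (swaps ignoring the rest), then the edges (swaps fixing the corners), then the
   centers (pure 3-cycles; two equally coloured centers absorb the parity).
   Twisting one fixed corner, or flipping one cubie of a pair, before assembling
   shifts one invariant and keeps the others, so all values of the invariants in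
   Z/3 x (Z/2)^12 are equally likely. *)
From HB Require Import structures.
Require Import Defs.
From mathcomp Require Import all_boot all_order all_algebra all_fingroup.

Set Implicit Arguments.
Unset Strict Implicit.
Unset Printing Implicit Defensive.

Import GRing.Theory.
Local Open Scope ring_scope.

(* Keeps unification and [done] from enumerating the facelets, which
   [vm_compute] still does; the locked definitions below have the same
   purpose. *)
Opaque facelet_seq positions.

Notation facelet_data := (vec * vec)%type.

(** * Reducing statements about facelets to finite computations *)

Lemma all_facelets (P : pred facelet_data) :
  all P facelet_seq -> forall f : facelet, P (ssval f).
Proof. by move/allP => allP f; apply: allP; apply: ssvalP. Qed.

Definition cubie (x : facelet_data) : seq facelet_data :=
  [seq y <- facelet_seq | x.1 == y.1].

Lemma mem_cubie (f g : facelet) :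
  fpos f = fpos g -> ssval g \in cubie (ssval f).
Proof. by rewrite mem_filter ssvalP andbT => fg; apply/eqP. Qed.

(** Enumerating the second facelet within the cubie of the first keeps the number of computed pairs
    small. *)
Lemma all_cubies (P : facelet_data -> pred facelet_data) :
  all (fun x => all (P x) (cubie x)) facelet_seq ->
  forall f g : facelet, fpos f = fpos g -> P (ssval f) (ssval g).
Proof. by move=> /all_facelets okP f g /mem_cubie; apply: (allP (okP f)). Qed.

Lemma all_facelets_if (C P : pred facelet_data) :
  all (fun x => C x ==> P x) facelet_seq ->
  forall f : facelet, C (ssval f) -> P (ssval f).
Proof. by move=> /all_facelets okP f; apply/implyP/okP. Qed.

Lemma all_cubies_if (C P : facelet_data -> pred facelet_data) :
  all (fun x => all (fun y => C x y ==> P x y) (cubie x)) facelet_seq ->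
  forall f g : facelet, fpos f = fpos g ->
  C (ssval f) (ssval g) -> P (ssval f) (ssval g).
Proof. by move=> /all_cubies okP f g fg; apply/implyP/okP. Qed.

Lemma has_facelet (P : pred facelet_data) :
  has P facelet_seq -> exists f : facelet, P (ssval f).
Proof. by case/hasP => x x_f Px; exists (SeqSub x_f). Qed.

Lemma facelet_seq_uniq : uniq facelet_seq.
Proof. by vm_compute. Qed.

Lemma map_enum_facelet :
  perm_eq (map (@ssval _ facelet_seq) (enum facelet)) facelet_seq.
Proof.
apply: uniq_perm (facelet_seq_uniq) _.
  by rewrite map_inj_uniq ?enum_uniq //; apply: val_inj.
move=> x; apply/mapP/idP => [[f _ ->]|x_f]; first exact: ssvalP.
by exists (SeqSub x_f); rewrite ?mem_enum.
Qed.

Lemma card_facelets (P : pred facelet_data) :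
  #|[set f : facelet | P (ssval f)]| = count P facelet_seq.
Proof.
rewrite cardsE cardE -size_filter.
rewrite -(perm_size (perm_filter P map_enum_facelet)) filter_map size_map.
by congr size; rewrite enumT.
Qed.

Lemma sum_facelets (V : nmodType) (P : pred facelet_data)
    (E : facelet_data -> V) :
  \sum_(f : facelet | P (ssval f)) E (ssval f)
    = foldr +%R 0 [seq E x | x <- facelet_seq & P x].
Proof.
rewrite foldrE big_map big_filter -(perm_big _ map_enum_facelet) big_map.
by rewrite big_enum_cond.
Qed.

(** The default [f] of [insubd] is never reached when [F] maps facelets to facelets, as
    [ssval_facelet_map] requires. *)
Definition facelet_map (F : facelet_data -> facelet_data) (f : facelet) :
    facelet :=
  insubd f (F (ssval f)).

Lemma ssval_facelet_map F :
  all (fun x => F x \in facelet_seq) facelet_seq ->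
  forall f, ssval (facelet_map F f) = F (ssval f).
Proof. by move=> /all_facelets F_f f; apply: insubdK; apply: F_f. Qed.

Lemma facelet_inj : injective (@ssval _ facelet_seq).
Proof. exact: val_inj. Qed.

(** * Configurations *)

Lemma fpos_positions (f : facelet) : fpos f \in positions.
Proof.
by apply: (all_facelets (P := fun x => x.1 \in positions)); vm_compute.
Qed.

Lemma card_facelets_at p : p \in positions -> #|facelets_at p| = kind p.
Proof.
move=> p_pos; rewrite /facelets_at (card_facelets (fun x => x.1 == p)).
apply/eqP; move: p p_pos; apply/allP.
by vm_compute.
Qed.

(** [clockwise] on raw vectors, where it can be evaluated. *)
Definition cw (x y z : facelet_data) : bool :=
  [&& x.1 == y.1, y.1 == z.1 & dot (cross x.2 y.2) z.2 == -1].

Section Conf.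
Variable s : {perm facelet}.

Section Elim.
Hypothesis conf_s : is_conf s.

Lemma conf_image f : exists p,
  [/\ kind p = kind (fpos f) & s @: facelets_at (fpos f) = facelets_at p].
Proof.
case/andP: conf_s => /allP/(_ _ (fpos_positions f))/hasP[p _].
by move=> /andP[/eqP kp /eqP im_s] _; exists p.
Qed.

(** The facelets of a position go onto all those of the image position, so injectivity keeps every
    other cubie out of it. *)
Lemma conf_pos f g : (fpos (s f) == fpos (s g)) = (fpos f == fpos g).
Proof.
have [p [_ im_s]] := conf_image f.
have: s f \in facelets_at p by rewrite -im_s imset_f ?inE.
rewrite inE => /eqP ->; rewrite eq_sym [RHS]eq_sym.
have -> : (fpos (s g) == p) = (s g \in facelets_at p) by rewrite inE.
by rewrite -im_s mem_imset ?inE //; apply: perm_inj.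
Qed.

Lemma conf_kind f : kind (fpos (s f)) = kind (fpos f).
Proof.
have [p [<- im_s]] := conf_image f.
have: s f \in facelets_at p by rewrite -im_s imset_f ?inE.
by rewrite inE => /eqP ->.
Qed.

Lemma conf_clockwise f g h : clockwise f g h -> clockwise (s f) (s g) (s h).
Proof.
by case/andP: conf_s => _ /forallP/(_ f)/forallP/(_ g)/forallP/(_ h)/implyP.
Qed.

End Elim.

(** A position [p] carries [kind p] facelets, so between positions of the same kind an inclusion of
    images is already an equality. *)
Lemma conf_intro :
    (forall f g, fpos f = fpos g -> fpos (s f) = fpos (s g)) ->
    (forall f, kind (fpos (s f)) = kind (fpos f)) ->
    (forall f g h, clockwise f g h -> clockwise (s f) (s g) (s h)) ->
  is_conf s.
Proof.
move=> pos_s kind_s cw_s; apply/andP; split; last first.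
  by do 3!apply/forallP=> ?; apply/implyP/cw_s.
apply/allP => p p_pos.
have [|[f f_p]] := set_0Vmem (facelets_at p).
  move/eqP; rewrite -cards_eq0 card_facelets_at //.
  by move: p_pos; rewrite mem_filter => /andP[+ _]; case: (kind p).
move: f_p; rewrite inE => /eqP pf.
apply/hasP; exists (fpos (s f)); first exact: fpos_positions.
rewrite kind_s pf eqxx /= eqEcard card_imset; last exact: perm_inj.
rewrite !card_facelets_at ?fpos_positions // kind_s pf leqnn andbT.
by apply/subsetP => _ /imsetP[g + ->]; rewrite !inE -pf => /eqP/pos_s ->.
Qed.

Definition conf_check (F : facelet_data -> facelet_data) : bool :=
  all (fun x => (kind (F x).1 == kind x.1) &&
    all (fun y => ((F x).1 == (F y).1) &&
      all (fun z => cw x y z ==> cw (F x) (F y) (F z)) (cubie x)) (cubie x))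
    facelet_seq.

Lemma conf_by_check F :
  (forall f, ssval (s f) = F (ssval f)) -> conf_check F -> is_conf s.
Proof.
move=> sF /all_facelets okF; apply: conf_intro => [f g fg|f|f g h cw_fgh].
- have /andP[_ /allP/(_ _ (mem_cubie fg))/andP[/eqP]] := okF f.
  by rewrite /fpos !sF.
- by have /andP[/eqP] := okF f; rewrite /fpos sF.
have /and3P[/eqP fg /eqP gh _] := cw_fgh.
have /andP[_ /allP/(_ _ (mem_cubie fg))/andP[_ /allP]] := okF f.
move=> /(_ _ (mem_cubie (etrans fg gh)))/implyP/(_ cw_fgh).
by rewrite /clockwise /cw /fpos /fnormal !sF.
Qed.

End Conf.

Lemma conf1 : is_conf 1.
Proof. by apply: conf_intro => [f g|f|f g h]; rewrite !perm1. Qed.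

Lemma confM s t : is_conf s -> is_conf t -> is_conf (s * t)%g.
Proof.
move=> cs ct; apply: conf_intro => [f g|f|f g h]; rewrite !permM.
- by move=> /eqP; rewrite -(conf_pos cs) -(conf_pos ct) => /eqP.
- by rewrite !conf_kind.
- by move/(conf_clockwise cs)/(conf_clockwise ct).
Qed.

Lemma ssval_turn F k f : ssval (turn F k f) = turn_pair F k (ssval f).
Proof. by rewrite permE. Qed.

Lemma conf_turn F k : is_conf (turn F k).
Proof.
apply: (conf_by_check (ssval_turn F k)).
by case: F; case: k; vm_compute.
Qed.

(** * Corner twists *)

(** The next facelet clockwise around a corner; the default of [head] makes it the identity on edges
    and centers. *)
Definition spin_data (x : facelet_data) : facelet_data :=
  head x [seq y <- cubie x | has (cw x y) (cubie x)].

HB.lock Definition spin : facelet -> facelet := facelet_map spin_data.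

Lemma ssval_spin f : ssval (spin f) = spin_data (ssval f).
Proof. by rewrite spin.unlock; apply: ssval_facelet_map; vm_compute. Qed.

Lemma clockwise_spin f g h : clockwise f g h -> g = spin f.
Proof.
move=> cw_fgh.
have chk : all (fun x => all (fun y =>
  has (cw x y) (cubie x) ==> (y == spin_data x)) (cubie x)) facelet_seq.
  by vm_compute.
have /and3P[/eqP fg /eqP gh _] := cw_fgh.
have: has (cw (ssval f) (ssval g)) (cubie (ssval f)).
  by apply/hasP; exists (ssval h); rewrite ?(mem_cubie (etrans fg gh)).
by move/(all_cubies_if chk fg)/eqP; rewrite -ssval_spin; apply: facelet_inj.
Qed.

Lemma spin_clockwise f :
  kind (fpos f) = 3%N -> clockwise f (spin f) (spin (spin f)).
Proof.
have chk : all (fun x => (kind x.1 == 3%N) ==>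
  cw x (spin_data x) (spin_data (spin_data x))) facelet_seq by vm_compute.
by move=> /eqP /(all_facelets_if chk); rewrite -!ssval_spin.
Qed.

Lemma spin_fixed f : kind (fpos f) != 3%N -> spin f = f.
Proof.
have chk : all (fun x => (kind x.1 != 3%N) ==> (spin_data x == x)) facelet_seq.
  by vm_compute.
move=> /(all_facelets_if chk)/eqP; rewrite -ssval_spin.
exact: facelet_inj.
Qed.

Lemma fpos_spin f : fpos (spin f) = fpos f.
Proof.
have [/eqP k3|/spin_fixed -> //] := boolP (kind (fpos f) == 3%N).
by have /and3P[/eqP -> _ _] := spin_clockwise k3.
Qed.

Lemma conf_spin s f : is_conf s -> s (spin f) = spin (s f).
Proof.
move=> cs; have [/eqP k3|k3] := boolP (kind (fpos f) == 3%N).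
  by apply/clockwise_spin/conf_clockwise/spin_clockwise.
by rewrite !spin_fixed // conf_kind.
Qed.

(* The number of clockwise steps, modulo 3, from the facelet with normal
   [+- e3] at the same corner. *)
Definition twist_at (x : facelet_data) : 'Z_3 :=
  let: (p1, p2, p3, (n1, n2, _)) := x in (sgz (p3 * (n2 * p1 - n1 * p2)))%:~R.

(** The facelet of a corner on the up or down face, from which twists are measured. *)
Definition is_ref (x : facelet_data) : bool :=
  (kind x.1 == 3%N) && (twist_at x == 0).

Definition ref_data (x : facelet_data) : facelet_data :=
  head x [seq y <- cubie x | is_ref y].

HB.lock Definition ref : facelet -> facelet := facelet_map ref_data.

Lemma ssval_ref f : ssval (ref f) = ref_data (ssval f).
Proof. by rewrite ref.unlock; apply: ssval_facelet_map; vm_compute. Qed.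

Lemma fpos_ref f : fpos (ref f) = fpos f.
Proof.
have chk : all (fun x => (ref_data x).1 == x.1) facelet_seq by vm_compute.
by have /eqP := all_facelets chk f; rewrite -ssval_ref.
Qed.

Lemma is_ref_ref f : kind (fpos f) = 3%N -> is_ref (ssval (ref f)).
Proof.
have chk : all (fun x => (kind x.1 == 3%N) ==> is_ref (ref_data x)) facelet_seq.
  by vm_compute.
by move=> /eqP /(all_facelets_if chk); rewrite -ssval_ref.
Qed.

Lemma ref_unique f g :
  is_ref (ssval f) -> is_ref (ssval g) -> fpos f = fpos g -> f = g.
Proof.
have chk : all (fun x => all (fun y =>
  is_ref x && is_ref y ==> (x == y)) (cubie x)) facelet_seq by vm_compute.
move=> rf rg fg; have := conj rf rg.
by move/andP/(all_cubies_if chk fg)/eqP/facelet_inj.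
Qed.

Lemma twist_at_spin f : kind (fpos f) = 3%N ->
  twist_at (ssval (spin f)) = twist_at (ssval f) + 1.
Proof.
have chk : all (fun x => (kind x.1 == 3%N) ==>
  (twist_at (spin_data x) == twist_at x + 1)) facelet_seq by vm_compute.
by move=> /eqP /(all_facelets_if chk)/eqP; rewrite -ssval_spin.
Qed.

Lemma spin_ref f : kind (fpos f) = 3%N ->
  [\/ f = ref f, f = spin (ref f) | f = spin (spin (ref f))].
Proof.
have chk : all (fun x => (kind x.1 == 3%N) ==>
  [|| x == ref_data x, x == spin_data (ref_data x)
    | x == spin_data (spin_data (ref_data x))]) facelet_seq by vm_compute.
move=> /eqP /(all_facelets_if chk); rewrite -ssval_ref -!ssval_spin.
by case/or3P => /eqP/facelet_inj ?; [constructor 1|constructor 2|constructor 3].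
Qed.

(** Since [s] commutes with [spin], it shifts the twist of all three facelets of a corner by one
    amount, read off at the reference facelet. *)
Lemma twist_at_conf s f : is_conf s -> kind (fpos f) = 3%N ->
  twist_at (ssval (s f)) = twist_at (ssval f) + twist_at (ssval (s (ref f))).
Proof.
move=> cs k3; have := spin_ref k3.
have kr : kind (fpos (ref f)) = 3%N by rewrite fpos_ref.
have /andP[_ /eqP tr0] := is_ref_ref k3.
have ks : kind (fpos (s (ref f))) = 3%N by rewrite conf_kind.
move: (ref f) kr tr0 ks => r kr tr0 ks.
case=> ->; rewrite ?(conf_spin _ cs) ?twist_at_spin ?fpos_spin // tr0 ?add0r //.
  by rewrite addrC.
by rewrite -addrA addrC.
Qed.

Definition twist (s : {perm facelet}) : 'Z_3 :=
  \sum_(f : facelet | is_ref (ssval f)) twist_at (ssval (s f)).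

(** By [twist_at_conf] each term splits in two; [f |-> ref (s f)] permutes the reference facelets,
    so the second parts sum to [twist t]. *)
Lemma twistM s t : is_conf s -> is_conf t ->
  twist (s * t)%g = twist s + twist t.
Proof.
move=> cs ct; rewrite /twist.
have ref3 (f : facelet) : is_ref (ssval f) -> kind (fpos f) = 3%N.
  by case/andP => /eqP.
have eq_st (f : facelet) : is_ref (ssval f) -> twist_at (ssval ((s * t)%g f))
    = twist_at (ssval (s f)) + twist_at (ssval (t (ref (s f)))).
  by move=> /ref3 k3; rewrite permM twist_at_conf ?conf_kind.
rewrite (eq_bigr _ eq_st) big_split /=; congr (_ + _).
pose C := [set f : facelet | is_ref (ssval f)].
have injC : {in C &, injective (fun f => ref (s f))}.
  move=> f g; rewrite !inE => rf rg /(congr1 fpos); rewrite !fpos_ref => /eqP.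
  by rewrite conf_pos // => /eqP /ref_unique ->.
have imC : [set ref (s f) | f in C] = C.
  apply/eqP; rewrite eqEcard card_in_imset // leqnn andbT.
  apply/subsetP => _ /imsetP[f + ->]; rewrite !inE => rf.
  by rewrite is_ref_ref // conf_kind ?ref3.
transitivity (\sum_(f in C) twist_at (ssval (t f))); last first.
  by apply: eq_bigl => f; rewrite inE.
rewrite -[in RHS]imC big_imset //=.
by apply: eq_bigl => f; rewrite inE.
Qed.

Lemma twist_eval (s : {perm facelet}) (F : facelet_data -> facelet_data) :
  (forall f : facelet, is_ref (ssval f) -> ssval (s f) = F (ssval f)) ->
  twist s = foldr +%R 0 [seq twist_at (F x) | x <- facelet_seq & is_ref x].
Proof.
move=> sF; rewrite -(sum_facelets is_ref (fun x => twist_at (F x))).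
by apply: eq_bigr => f /sF ->.
Qed.

Lemma twist_turn F k : twist (turn F k) = 0.
Proof.
rewrite (twist_eval (fun f _ => ssval_turn F k f)).
by case: F; case: k; apply/eqP; vm_compute.
Qed.

Lemma twist1 : twist 1 = 0.
Proof.
by rewrite /twist big1 // => f /andP[_ /eqP]; rewrite perm1.
Qed.

(** * Edge chirality *)

(* At an edge position [p = 3 n + 3 m + v] with normals [n] and [m], the value at
   [n] is [- 24 det(n, m, v)]; it vanishes on corners and centers.  Rotations are
   signed permutations of the coordinates, so they commute with cubing. *)
Definition chirality (x : facelet_data) : int :=
  let: (p1, p2, p3) := x.1 in
  dot (cross x.2 x.1) (p1 * p1 * p1, p2 * p2 * p2, p3 * p3 * p3).

Definition chir (f : facelet) : int := chirality (ssval f).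

(** An edge position has one coordinate 1 or -1; changing its sign leads to the other edge cubie
    between the same two faces. *)
Definition reflect_coord (a : int) : int :=
  if (a == 1) || (a == -1) then - a else a.

(* On edges: the facelet with the same colour on the other edge cubie with the
   same pair of colours. *)
Definition mate_data (x : facelet_data) : facelet_data :=
  let: (p1, p2, p3, n) := x in
  (reflect_coord p1, reflect_coord p2, reflect_coord p3, n).

HB.lock Definition mate : facelet -> facelet := facelet_map mate_data.

(** The other facelet of an edge cubie; the identity on corners and centers. *)
Definition twin_data (x : facelet_data) : facelet_data :=
  if kind x.1 == 2%N then head x [seq y <- cubie x | y.2 != x.2] else x.

HB.lock Definition twin : facelet -> facelet := facelet_map twin_data.

Lemma ssval_mate f : ssval (mate f) = mate_data (ssval f).
Proof. by rewrite mate.unlock; apply: ssval_facelet_map; vm_compute. Qed.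

Lemma ssval_twin f : ssval (twin f) = twin_data (ssval f).
Proof. by rewrite twin.unlock; apply: ssval_facelet_map; vm_compute. Qed.

Lemma mateK : involutive mate.
Proof.
have chk : all (fun x => mate_data (mate_data x) == x) facelet_seq.
  by vm_compute.
move=> f; have /eqP := all_facelets chk f.
by rewrite -!ssval_mate => /facelet_inj.
Qed.

Lemma twinK : involutive twin.
Proof.
have chk : all (fun x => twin_data (twin_data x) == x) facelet_seq.
  by vm_compute.
move=> f; have /eqP := all_facelets chk f.
by rewrite -!ssval_twin => /facelet_inj.
Qed.

Lemma mate_twin f : mate (twin f) = twin (mate f).
Proof.
have chk : all (fun x => mate_data (twin_data x) == twin_data (mate_data x))
  facelet_seq by vm_compute.
have /eqP := all_facelets chk f.
by rewrite -ssval_mate -!ssval_twin -ssval_mate => /facelet_inj.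
Qed.

Lemma fnormal_mate f : fnormal (mate f) = fnormal f.
Proof. by rewrite /fnormal ssval_mate; case: (ssval f) => [[[]]]. Qed.

Lemma fpos_twin f : fpos (twin f) = fpos f.
Proof.
have chk : all (fun x => (twin_data x).1 == x.1) facelet_seq by vm_compute.
by have /eqP := all_facelets chk f; rewrite -ssval_twin.
Qed.

Lemma chir_mate f : chir (mate f) = - chir f.
Proof.
have chk : all (fun x => chirality (mate_data x) == - chirality x) facelet_seq.
  by vm_compute.
by have /eqP := all_facelets chk f; rewrite -ssval_mate.
Qed.

Lemma chir_twin f : chir (twin f) = - chir f.
Proof.
have chk : all (fun x => chirality (twin_data x) == - chirality x) facelet_seq.
  by vm_compute.
by have /eqP := all_facelets chk f; rewrite -ssval_twin.
Qed.

Lemma chir_turn F k f : chir (turn F k f) = chir f.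
Proof.
rewrite /chir ssval_turn; apply/eqP.
have chk : all (fun x => chirality (turn_pair F k x) == chirality x)
    facelet_seq.
  by case: F; case: k; vm_compute.
exact: all_facelets chk f.
Qed.

Lemma chir_edge f : kind (fpos f) = 2%N -> chir f = 24 \/ chir f = -24.
Proof.
have chk : all (fun x => (kind x.1 == 2%N) ==>
  (chirality x == 24) || (chirality x == -24)) facelet_seq by vm_compute.
by move=> /eqP/(all_facelets_if chk)/orP[]/eqP; [left|right].
Qed.

Lemma chir_nonedge f : kind (fpos f) != 2%N -> chir f = 0.
Proof.
have chk : all (fun x => (kind x.1 != 2%N) ==> (chirality x == 0)) facelet_seq.
  by vm_compute.
by move=> /(all_facelets_if chk)/eqP.
Qed.

Lemma twin_neq f : kind (fpos f) = 2%N -> twin f != f.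
Proof.
move=> /chir_edge chir_f; apply/eqP => tf.
by have := chir_twin f; rewrite tf; case: chir_f => ->.
Qed.

Lemma twin_unique f g :
  kind (fpos f) = 2%N -> fpos f = fpos g -> f != g -> g = twin f.
Proof.
have chk : all (fun x => all (fun y =>
    (kind x.1 == 2%N) && (x != y) ==> (y == twin_data x)) (cubie x))
  facelet_seq.
  by vm_compute.
move=> /eqP k2 fg neq_fg.
have hyp : (kind (ssval f).1 == 2%N) && (ssval f != ssval g).
  by rewrite [kind _ == _]k2; apply: contra neq_fg => /eqP/facelet_inj ->.
have /eqP := all_cubies_if chk fg hyp; rewrite -ssval_twin.
exact: facelet_inj.
Qed.

Lemma twin_fixed f : kind (fpos f) != 2%N -> twin f = f.
Proof.
by move=> k2; apply: facelet_inj; rewrite ssval_twin /twin_data ifN.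
Qed.

Lemma conf_twin s f : is_conf s -> s (twin f) = twin (s f).
Proof.
move=> cs; have [/eqP k2|k2] := boolP (kind (fpos f) == 2%N); last first.
  by rewrite !twin_fixed // conf_kind.
apply: twin_unique; rewrite ?conf_kind //.
  by apply/eqP; rewrite conf_pos // fpos_twin.
by rewrite (inj_eq perm_inj) eq_sym twin_neq.
Qed.

(** Two adjacent faces share just two edge positions, so the normals of an edge facelet and of its
    twin leave only the facelet and its mate. *)
Lemma mate_unique f g : kind (fpos f) = 2%N -> kind (fpos g) = 2%N ->
  f != g -> fnormal f = fnormal g -> fnormal (twin f) = fnormal (twin g) ->
  g = mate f.
Proof.
have chk : all (fun x => all (fun y =>
    [&& kind x.1 == 2%N, kind y.1 == 2%N, x != y, x.2 == y.2 &
        (twin_data x).2 == (twin_data y).2] ==> (y == mate_data x))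
    [seq y <- facelet_seq | x.2 == y.2]) facelet_seq.
  by vm_compute.
move=> /eqP kf /eqP kg neq_fg /eqP nfg.
rewrite /fnormal !ssval_twin => /eqP tfg.
have gf : ssval g \in [seq y <- facelet_seq | (ssval f).2 == y.2].
  by rewrite mem_filter nfg ssvalP.
have /implyP imp := allP (all_facelets chk f) _ gf.
have /imp/eqP : [&& kind (ssval f).1 == 2%N, kind (ssval g).1 == 2%N,
    ssval f != ssval g, (ssval f).2 == (ssval g).2 &
    (twin_data (ssval f)).2 == (twin_data (ssval g)).2].
  rewrite [kind (ssval f).1 == _]kf [kind _ == _]kg nfg tfg !andbT.
  by apply: contra neq_fg => /eqP/facelet_inj ->.
by rewrite -ssval_mate => /facelet_inj.
Qed.

(** * Invariants *)

(* The two edge cubies with the same colours are both flipped or both not. *)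
Definition paired (s : {perm facelet}) (f : facelet) : bool :=
  chir (s (mate f)) == - chir (s f).

Definition invariant_set : {set {perm facelet}} :=
  [set g | [&& is_conf g, twist g == 0 & [forall f, chir (g f) == chir f]]].

Lemma invariant_group_set : group_set invariant_set.
Proof.
apply/group_setP; split=> [|g h].
  rewrite inE conf1 twist1 eqxx; apply/forallP=> f.
  by rewrite perm1.
rewrite !inE => /and3P[cg /eqP tg /forallP xg] /and3P[ch /eqP th /forallP xh].
rewrite confM // twistM // tg th addr0 eqxx; apply/forallP => f.
by rewrite permM (eqP (xh _)).
Qed.

Canonical invariant_group := Group invariant_group_set.

(** Every turn lies in [invariant_group], which is closed under products because [twist] is
    additive; hence so does the group they generate. *)
Lemma cube_group_invariant g : g \in cube_group ->
  [/\ is_conf g, twist g = 0 & forall f, chir (g f) = chir f].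
Proof.
have sub : cube_group \subset invariant_group.
  have turn_inv F k : turn F k \in invariant_group.
    rewrite inE conf_turn twist_turn eqxx.
    by apply/forallP=> f; rewrite chir_turn.
  rewrite gen_subG; apply/subsetP => t; rewrite inE /quarter_turns /=.
  by rewrite !in_cons in_nil orbF; do 11?[case/orP]; move/eqP ->.
by move/(subsetP sub); rewrite inE => /and3P[cg /eqP tg /forallP xg];
   split=> // f; apply/eqP.
Qed.

(** * Solving *)

Lemma face_eq_dec (F G : face) : {F = G} + {F <> G}.
Proof. by decide equality. Qed.

HB.instance Definition _ := hasDecEq.Build face (compareP face_eq_dec).

Lemma slice_eq_dec (k l : slice) : {k = l} + {k <> l}.
Proof. by decide equality. Qed.

HB.instance Definition _ := hasDecEq.Build slice (compareP slice_eq_dec).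

(* A move [(F, k, n)] is [n] successive clockwise quarter turns. *)
Definition move : Type := (face * slice * nat)%type.

Definition run_move (x : facelet_data) (m : move) : facelet_data :=
  let: (F, k, n) := m in iter n (turn_pair F k) x.

Definition run (w : seq move) (x : facelet_data) : facelet_data :=
  foldl run_move x w.

Fixpoint word_perm (w : seq move) : {perm facelet} :=
  if w is (F, k, n) :: w' then (turn F k ^+ n * word_perm w')%g else 1%g.

Lemma turn_cube F k : turn F k \in cube_group.
Proof.
apply/mem_gen; rewrite inE /quarter_turns /= !in_cons.
by case: F; case: k; rewrite eqxx ?orbT.
Qed.

Lemma word_perm_cube w : word_perm w \in cube_group.
Proof.
elim: w => [|[[F k] n] w IHw] /=; first exact: group1.
by rewrite groupM ?groupX ?turn_cube.
Qed.

Lemma ssval_word_perm w f : ssval (word_perm w f) = run w (ssval f).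
Proof.
elim: w f => [|[[F k] n] w IHw] f /=; first by rewrite perm1.
rewrite permM IHw /run /=; congr foldl.
elim: n => [|n IHn] /=; first by rewrite expg0 perm1.
by rewrite expgSr permM ssval_turn IHn.
Qed.

(** * Searching orbits under turns that fix given facelets *)

Definition turns_fixing (fixed : seq facelet_data) : seq (face * slice) :=
  [seq m <- [seq (F, k) | F <- faces, k <- slices]
     | all (fun x => turn_pair m.1 m.2 x == x) fixed].

Definition sweep (ms : seq (face * slice)) (xs : seq facelet_data) :=
  undup (xs ++ [seq turn_pair m.1 m.2 x | m <- ms, x <- xs]).

(* [n] bounds the length of the words considered; [7] suffices throughout. *)
Definition orbit_check (n : nat) (fixed : seq facelet_data) (b : facelet_data)
    (P : pred facelet_data) : bool :=
  let xs := iter n (sweep (turns_fixing fixed)) [:: b] in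
  all (fun x => P x ==> (x \in xs)) facelet_seq.

Lemma sweep_reachable n fixed (b : facelet) x :
    x \in iter n (sweep (turns_fixing fixed)) [:: ssval b] ->
  exists g, [/\ g \in cube_group, ssval (g b) = x &
                forall h : facelet, ssval h \in fixed -> g h = h].
Proof.
elim: n x => [|n IHn] x /=.
  rewrite inE => /eqP ->; exists 1%g; split; rewrite ?group1 ?perm1 // => h _.
  by rewrite perm1.
rewrite mem_undup mem_cat => /orP[/IHn //|/allpairsP[[[F k] y] /= [m_fix]]].
move=> /IHn[g [g_cube <- g_fix]] ->.
exists (g * turn F k)%g; split; rewrite ?permM ?ssval_turn //.
  by rewrite groupM ?turn_cube.
move=> h h_fixed; rewrite permM g_fix //; apply: facelet_inj.
rewrite ssval_turn; apply/eqP; move: m_fix; rewrite mem_filter => /andP[+ _].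
by move/allP; apply.
Qed.

(** The search starts at the target [b], so the element it yields is inverted; it uses only turns
    that fix the facelets in [fixed]. *)
Lemma orbit_checkP n fixed (b : facelet) P : orbit_check n fixed (ssval b) P ->
  forall f : facelet, P (ssval f) ->
  exists g, [/\ g \in cube_group, g f = b &
                forall h : facelet, ssval h \in fixed -> g h = h].
Proof.
rewrite /orbit_check => chk f Pf.
have /sweep_reachable[g [g_cube gb g_fix]] : ssval f \in
    iter n (sweep (turns_fixing fixed)) [:: ssval b].
  exact: (all_facelets_if chk Pf).
exists g^-1%g; split; first by rewrite groupV.
  by rewrite -(facelet_inj gb) permK.
by move=> h /g_fix {1}<-; rewrite permK.
Qed.

(** * Swapping corners, swapping edges, cycling centers *)

Definition corner_a : facelet_data := (3, -3%:Z, 3, e3).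
Definition corner_b : facelet_data := (3, 3, 3, e3).
(* R U R' U' R' F R2 U' R' U' R U R' F' *)
Definition corner_word : seq move :=
  [:: (Right, External, 1); (Up, External, 1); (Right, External, 3);
      (Up, External, 3); (Right, External, 3); (Front, External, 1);
      (Right, External, 2); (Up, External, 3); (Right, External, 3);
      (Up, External, 3); (Right, External, 1); (Up, External, 1);
      (Right, External, 3); (Front, External, 3)]%N.

Definition edge_a : facelet_data := (-3%:Z, -3%:Z, 1, outward Front).
Definition edge_b : facelet_data := (3, -3%:Z, 1, e1).
(* R' [B' U' B, C_U] R C_U: a 3-cycle of edges times a 4-cycle. *)
Definition edge_word : seq move :=
  [:: (Right, External, 3); (Back, External, 3); (Up, External, 3);
      (Back, External, 1); (Up, Central, 1); (Back, External, 3);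
      (Up, External, 1); (Back, External, 1); (Up, Central, 3);
      (Right, External, 1); (Up, Central, 1)]%N.

Definition center_a : facelet_data := (1, -3%:Z, 1, outward Front).
Definition center_b : facelet_data := (3, 1, 1, e1).
Definition center_c : facelet_data := (1, -1%:Z, -3%:Z, outward Down).
(* [B C_R B', C_U] *)
Definition center_word : seq move :=
  [:: (Back, External, 1); (Right, Central, 1); (Back, External, 3);
      (Up, Central, 1); (Back, External, 1); (Right, Central, 3);
      (Back, External, 3); (Up, Central, 3)]%N.

Lemma facelet_of x : x \in facelet_seq -> {f : facelet | ssval f = x}.
Proof. by move=> x_f; exists (SeqSub x_f). Qed.

Opaque run.

(** Conjugation by [u] carries the effect of one fixed word over to other facelets. *)
Lemma conjugate_word ws (u : {perm facelet}) : u \in cube_group ->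
  exists2 g, g \in cube_group &
    forall x y, run ws (ssval (u x)) = ssval (u y) -> g x = y.
Proof.
move=> u_cube; exists (u * word_perm ws * u^-1)%g.
  by rewrite !groupM ?groupV ?word_perm_cube.
move=> x y run_xy; rewrite !permM -[RHS](permK u); congr (_ _).
by apply: facelet_inj; rewrite ssval_word_perm.
Qed.

Lemma corner_word_swap : run corner_word corner_a = corner_b.
Proof. by apply/eqP; vm_compute. Qed.

Lemma corner_word_fixed (f : facelet) :
    [&& kind (fpos f) == 3%N, fpos f != corner_a.1 & fpos f != corner_b.1] ->
  run corner_word (ssval f) = ssval f.
Proof.
have chk : all (fun x =>
    [&& kind x.1 == 3%N, x.1 != corner_a.1 & x.1 != corner_b.1] ==>
    (run corner_word x == x)) facelet_seq by vm_compute.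
by move=> hyp; apply/eqP; have := all_facelets_if chk hyp.
Qed.

(** The two corners are brought to those that [corner_word] exchanges, and the word is conjugated.
    Facelets rather than positions are prescribed, so the corner arrives with a chosen orientation;
    edges and centers may be disturbed. *)
Lemma corner_swap f h :
    kind (fpos f) = 3%N -> kind (fpos h) = 3%N -> fpos f != fpos h ->
  exists g, [/\ g \in cube_group, g f = h &
    forall z, kind (fpos z) = 3%N -> fpos z != fpos f -> fpos z != fpos h ->
    g z = z].
Proof.
move=> kf kh neq_fh.
have [a ea] : {a : facelet | ssval a = corner_a}.
  by apply: facelet_of; vm_compute.
have [b eb] : {b : facelet | ssval b = corner_b}.
  by apply: facelet_of; vm_compute.
have [u [u_cube uf _]] : exists u, [/\ u \in cube_group, u f = a &
    forall h : facelet, ssval h \in [::] -> u h = h].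
  apply: (orbit_checkP (n := 7) (P := fun x => kind x.1 == 3%N)).
    by rewrite ea; vm_compute.
  exact/eqP.
have [cu _ _] := cube_group_invariant u_cube.
(* The second search uses only turns fixing [corner_a], so [v] does not undo [u]. *)
have [v [v_cube vh v_fix]] : exists v, [/\ v \in cube_group, v (u h) = b &
    forall h : facelet, ssval h \in [:: corner_a] -> v h = h].
  apply: (orbit_checkP (n := 7)
    (P := fun x => (kind x.1 == 3%N) && (x.1 != corner_a.1))).
    by rewrite eb; vm_compute.
  apply/andP; split; first by rewrite [kind _]conf_kind ?kh.
  by rewrite -ea -uf [_ == _]conf_pos 1?eq_sym.
have [cv _ _] := cube_group_invariant v_cube.
have va : v a = a by apply: v_fix; rewrite ea mem_head.
pose w := (u * v)%g; have w_cube : w \in cube_group by exact: groupM.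
have cw : is_conf w by rewrite confM.
have wf : w f = a by rewrite permM uf.
have wh : w h = b by rewrite permM.
have [g g_cube g_word] := conjugate_word corner_word w_cube.
exists g; split; first exact: g_cube.
  by apply: g_word; rewrite wf wh ea eb corner_word_swap.
move=> z kz zf zh; apply/g_word/corner_word_fixed.
rewrite -ea -eb -wf -wh -/(fpos (w f)) -/(fpos (w h)).
by rewrite !conf_pos // conf_kind // kz zf zh.
Qed.

Lemma edge_word_swap : run edge_word edge_a = edge_b.
Proof. by apply/eqP; vm_compute. Qed.

Lemma edge_word_fixed (f : facelet) :
    (kind (fpos f) == 3%N) ||
    [&& chir f == 24, ssval f != edge_a & ssval f != edge_b] ->
  run edge_word (ssval f) = ssval f.
Proof.
have chk : all (fun x => (kind x.1 == 3%N) ||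
    [&& chirality x == 24, x != edge_a & x != edge_b] ==>
    (run edge_word x == x)) facelet_seq by vm_compute.
by move=> hyp; apply/eqP; have := all_facelets_if chk hyp.
Qed.

(** Exactly one facelet of each edge cubie has chirality 24, so these represent the edge cubies. On
    them [edge_word] is a transposition, the slice turn supplying the odd parity, and conjugation
    yields all other transpositions. *)
Lemma edge_swap f h : chir f = 24 -> chir h = 24 -> f != h ->
  exists g, [/\ g \in cube_group, g f = h,
    forall z, kind (fpos z) = 3%N -> g z = z &
    forall z, chir z = 24 -> z != f -> z != h -> g z = z].
Proof.
move=> xf xh neq_fh.
have [a ea] : {a : facelet | ssval a = edge_a}.
  by apply: facelet_of; vm_compute.
have [b eb] : {b : facelet | ssval b = edge_b}.
  by apply: facelet_of; vm_compute.
have [u [u_cube uf _]] : exists u, [/\ u \in cube_group, u f = a &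
    forall h : facelet, ssval h \in [::] -> u h = h].
  apply: (orbit_checkP (n := 7) (P := fun x => chirality x == 24)).
    by rewrite ea; vm_compute.
  exact/eqP.
have [_ _ xu] := cube_group_invariant u_cube.
have [v [v_cube vh v_fix]] : exists v, [/\ v \in cube_group, v (u h) = b &
    forall h : facelet, ssval h \in [:: edge_a] -> v h = h].
  apply: (orbit_checkP (n := 7)
    (P := fun x => (chirality x == 24) && (x != edge_a))).
    by rewrite eb; vm_compute.
  apply/andP; split; first by rewrite [chirality _]xu xh.
  by rewrite -ea -uf (inj_eq facelet_inj) (inj_eq perm_inj) eq_sym.
have va : v a = a by apply: v_fix; rewrite ea mem_head.
pose w := (u * v)%g; have w_cube : w \in cube_group by exact: groupM.
have [cw _ xw] := cube_group_invariant w_cube.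
have wf : w f = a by rewrite permM uf.
have wh : w h = b by rewrite permM.
have [g g_cube g_word] := conjugate_word edge_word w_cube.
exists g; split.
- exact: g_cube.
- by apply: g_word; rewrite wf wh ea eb edge_word_swap.
- move=> z kz; apply/g_word/edge_word_fixed.
  by rewrite conf_kind ?kz.
move=> z xz zf zh; apply/g_word/edge_word_fixed.
rewrite xw xz -ea -eb -wf -wh.
by rewrite !(inj_eq facelet_inj) !(inj_eq perm_inj) zf zh orbT.
Qed.

Lemma center_word_cycle : run center_word center_a = center_b.
Proof. by apply/eqP; vm_compute. Qed.

Lemma center_word_fixed (f : facelet) :
    [&& ssval f != center_a, ssval f != center_b & ssval f != center_c] ->
  run center_word (ssval f) = ssval f.
Proof.
have chk : all (fun x =>
    [&& x != center_a, x != center_b & x != center_c] ==>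
    (run center_word x == x)) facelet_seq by vm_compute.
by move=> hyp; apply/eqP; have := all_facelets_if chk hyp.
Qed.

(** A conjugate of [center_word]: three successive searches bring the facelets into place, each
    fixing those already there. *)
Lemma center_cycle f h k :
    kind (fpos f) = 1%N -> kind (fpos h) = 1%N -> kind (fpos k) = 1%N ->
    f != h -> f != k -> h != k ->
  exists g, [/\ g \in cube_group, g f = h &
    forall z, z != f -> z != h -> z != k -> g z = z].
Proof.
move=> kf kh kk neq_fh neq_fk neq_hk.
have [a ea] : {a : facelet | ssval a = center_a}.
  by apply: facelet_of; vm_compute.
have [b eb] : {b : facelet | ssval b = center_b}.
  by apply: facelet_of; vm_compute.
have [c ec] : {c : facelet | ssval c = center_c}.
  by apply: facelet_of; vm_compute.
have [u [u_cube uf _]] : exists u, [/\ u \in cube_group, u f = a &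
    forall h : facelet, ssval h \in [::] -> u h = h].
  apply: (orbit_checkP (n := 7) (P := fun x => kind x.1 == 1%N)).
    by rewrite ea; vm_compute.
  exact/eqP.
have [cu _ _] := cube_group_invariant u_cube.
have [v [v_cube vh v_fix]] : exists v, [/\ v \in cube_group, v (u h) = b &
    forall h : facelet, ssval h \in [:: center_a] -> v h = h].
  apply: (orbit_checkP (n := 7)
    (P := fun x => (kind x.1 == 1%N) && (x != center_a))).
    by rewrite eb; vm_compute.
  apply/andP; split; first by rewrite [kind _]conf_kind ?kh.
  by rewrite -ea -uf (inj_eq facelet_inj) (inj_eq perm_inj) eq_sym.
have [cv _ _] := cube_group_invariant v_cube.
have va : v a = a by apply: v_fix; rewrite ea mem_head.
have [w [w_cube wk w_fix]] : exists w, [/\ w \in cube_group, w (v (u k)) = c &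
    forall h : facelet, ssval h \in [:: center_a; center_b] -> w h = h].
  apply: (orbit_checkP (n := 7)
    (P := fun x => [&& kind x.1 == 1%N, x != center_a & x != center_b])).
    by rewrite ec; vm_compute.
  apply/and3P; split; first by rewrite [kind _]conf_kind ?conf_kind ?kk.
    rewrite -ea -va -uf (inj_eq facelet_inj) !(inj_eq perm_inj).
    by rewrite eq_sym.
  by rewrite -eb -vh (inj_eq facelet_inj) !(inj_eq perm_inj) eq_sym.
have wa : w a = a by apply: w_fix; rewrite ea mem_head.
have wb : w b = b by apply: w_fix; rewrite eb !inE eqxx orbT.
pose r := (u * v * w)%g.
have r_cube : r \in cube_group by rewrite /r !groupM.
have rf : r f = a by rewrite !permM uf va.
have rh : r h = b by rewrite !permM vh.
have rk : r k = c by rewrite !permM.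
have [g g_cube g_word] := conjugate_word center_word r_cube.
exists g; split; first exact: g_cube.
  by apply: g_word; rewrite rf rh ea eb center_word_cycle.
move=> z zf zh zk; apply/g_word/center_word_fixed.
rewrite -ea -eb -ec -rf -rh -rk !(inj_eq facelet_inj) !(inj_eq perm_inj).
by rewrite zf zh zk.
Qed.

(** * Assembling the corners, then the edges, then the centers *)

(** Greedy placement: the elements of [l] go one by one to their targets under [tau]; a step may
    disturb anything but the targets already filled, as long as [I] survives. *)
Lemma place_sequentially (T : finType) (G : {group {perm T}}) (tau : T -> T)
    (I : {perm T} -> Prop) (s : {perm T}) (l : seq T) :
    uniq l -> I s ->
    (forall (l1 : seq T) x (s' : {perm T}),
       x \in l -> x \notin l1 -> {subset l1 <= l} ->
       I s' -> {in l1, s' =1 tau} -> s' x != tau x ->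
       exists g, [/\ g \in G, I (s' * g)%g, g (s' x) = tau x &
                     {in l1, forall z, g (tau z) = tau z}]) ->
  exists g, [/\ g \in G, I (s * g)%g & {in l, (s * g)%g =1 tau}].
Proof.
move=> uniq_l Is step.
suff [g [gG Isg gl]] : exists g, [/\ g \in G, I (s * g)%g &
    forall z, z \in take (size l) l -> (s * g)%g z = tau z].
  by exists g; rewrite take_size in gl.
(* Induction on the length of the prefix of [l] already placed. *)
elim: {-2}(size l) (leqnn (size l)) => [|n IHn] lt_n.
  by exists 1%g; rewrite group1 mulg1 take0; split.
have [g [gG Isg gl]] := IHn (ltnW lt_n).
have [x0 _] : exists x0 : T, x0 \in l.
  by case: (l) lt_n => // x0 l' _; exists x0; rewrite mem_head.
rewrite (take_nth x0) //; set x := nth x0 l n; set l1 := take n l in gl *.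
have [sgx|sgx] := eqVneq ((s * g)%g x) (tau x).
  exists g; split=> // z; rewrite mem_rcons inE => /orP[/eqP -> //|].
  exact: gl.
have x_l : x \in l by apply: mem_nth.
have x_l1 : x \notin l1.
  move: uniq_l; rewrite -{1}(cat_take_drop n l) (drop_nth x0) // cat_uniq.
  by case/and3P => _ /norP[].
have l1_l : {subset l1 <= l} by apply: mem_subseq; apply: take_subseq.
have [h [hG Ish hx hl1]] := step l1 x _ x_l x_l1 l1_l Isg gl sgx.
exists (g * h)%g; rewrite groupM // mulgA; split=> // z.
rewrite mem_rcons inE permM => /orP[/eqP -> //|z_l1].
by rewrite gl // hl1.
Qed.

(** Once the reference stickers of all corners but one are home, the last corner has no choice of
    position, and zero twist leaves it no choice of orientation. *)
Lemma solve_corners s : is_conf s -> twist s = 0 ->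
  exists2 g, g \in cube_group &
    forall f, kind (fpos f) = 3%N -> (s * g)%g f = f.
Proof.
move=> cs ts.
have [r er] : {r : facelet | ssval r = corner_b}.
  by apply: facelet_of; vm_compute.
have rr : is_ref (ssval r) by rewrite er; vm_compute.
have ref3 (f : facelet) : is_ref (ssval f) -> kind (fpos f) = 3%N.
  by case/andP => /eqP.
pose l := [seq f <- enum facelet | is_ref (ssval f) && (f != r)].
have mem_l f : (f \in l) = is_ref (ssval f) && (f != r).
  by rewrite mem_filter mem_enum andbT.
have ref_pos f h : is_ref (ssval f) -> is_ref (ssval h) -> f != h ->
    fpos f != fpos h.
  by move=> rf rh; apply: contra => /eqP /ref_unique ->.
have [| | |g [g_cube csg gl]] :=
  @place_sequentially _ cube_group id is_conf s l.
- by rewrite filter_uniq ?enum_uniq.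
- exact: cs.
- move=> l1 x s'; rewrite mem_l => /andP[rx xr] x_l1 l1_l cs' fix_l1 s'x.
  have kx := ref3 _ rx; have kr := ref3 _ rr.
  have ks'x : kind (fpos (s' x)) = 3%N by rewrite conf_kind.
  have l1P z : z \in l1 -> [/\ kind (fpos z) = 3%N, fpos z != fpos x,
      fpos z != fpos r & fpos z != fpos (s' x)].
    move=> z_l1; have := l1_l z z_l1; rewrite mem_l => /andP[rz zr].
    have zx : z != x by apply: contraNneq x_l1 => <-.
    split; [exact: ref3|exact: ref_pos|exact: ref_pos|].
    by rewrite -[z in fpos z](fix_l1 z z_l1) conf_pos // ref_pos.
  have [eq_pos|neq_pos] := eqVneq (fpos (s' x)) (fpos x).
    (* A corner twisted in place goes home through the position of [r]. *)
    have [|g [g_cube gx g_fix]] := corner_swap ks'x kr.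
      by rewrite eq_pos ref_pos.
    have [|h [h_cube hr h_fix]] := corner_swap kr kx.
      by rewrite eq_sym ref_pos.
    have gh_cube : (g * h)%g \in cube_group by exact: groupM.
    have [cgh _ _] := cube_group_invariant gh_cube.
    exists (g * h)%g; split; [exact: gh_cube|exact: confM| |].
      by rewrite permM gx.
    move=> z z_l1; have [kz zx zr zs'x] := l1P z z_l1.
    by rewrite permM g_fix // h_fix.
  have [g [g_cube gx g_fix]] := corner_swap ks'x kx neq_pos.
  have [cg _ _] := cube_group_invariant g_cube.
  exists g; split; [exact: g_cube|exact: confM|exact: gx|].
  by move=> z z_l1; have [kz zx zr zs'x] := l1P z z_l1; rewrite g_fix.
have [cg tg _] := cube_group_invariant g_cube.
exists g; first exact: g_cube.
have tsg : twist (s * g)%g = 0 by rewrite twistM // ts tg addr0.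
move: (s * g)%g csg gl tsg => t ct tl tt.
(* At any other corner [t r] would share its position with a reference sticker already home
   there. *)
have t_pos : fpos (t r) = fpos r.
  have kr := ref3 _ rr; have ktr : kind (fpos (t r)) = 3%N by rewrite conf_kind.
  have [eq_r|neq_r] := eqVneq (ref (t r)) r.
    by rewrite -[in RHS]eq_r fpos_ref.
  have q_l : ref (t r) \in l by rewrite mem_l neq_r is_ref_ref.
  have : fpos (t (ref (t r))) == fpos (t r) by rewrite tl // fpos_ref.
  rewrite conf_pos // => /eqP /ref_unique eq_r.
  by rewrite eq_r ?is_ref_ref ?eqxx in neq_r.
have t_r : t r = r.
  apply: ref_unique => //; rewrite /is_ref [kind _]conf_kind // ref3 //=.
  (* All other reference stickers are home and contribute zero, so the total twist is that of the
     sticker [r]. *)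
  rewrite -{}tt /twist (bigD1 r) //= big1 ?addr0 // => f /andP[rf fr].
  by rewrite tl ?mem_l ?rf //; case/andP: rf => _ /eqP.
have t_ref f : kind (fpos f) = 3%N -> t (ref f) = ref f.
  move=> kf; have [-> //|neq_r] := eqVneq (ref f) r.
  by apply: tl; rewrite mem_l neq_r is_ref_ref.
move=> f kf; have tr := t_ref f kf.
by case: (spin_ref kf) => ->; rewrite ?(conf_spin _ ct) tr.
Qed.

(** Moves preserve chirality, so a sticker at a place of the wrong chirality for its home is sent to
    the mate of its home, which has the same normal. Pairing makes these targets distinct. Centers
    may be disturbed. *)
Lemma solve_edges s : is_conf s -> (forall f, paired s f) ->
    (forall f, kind (fpos f) = 3%N -> s f = f) ->
  exists2 g, g \in cube_group & forall f, kind (fpos f) != 1%N ->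
    fnormal ((s * g)%g f) = fnormal f.
Proof.
move=> cs /(_ _)/eqP s_paired s_corner.
pose tau f := if chir (s f) == chir f then f else mate f.
have tau_normal f : fnormal (tau f) = fnormal f.
  by rewrite /tau; case: ifP => // _; rewrite fnormal_mate.
have edge24 f : chir f = 24 -> kind (fpos f) = 2%N.
  move=> xf; apply/eqP; apply: contra_eqT xf => /chir_nonedge ->.
  by [].
pose I (t : {perm facelet}) := [/\ is_conf t, forall f, chir (t f) = chir (s f)
  & forall f, kind (fpos f) = 3%N -> t f = f].
have I_mul t g : I t -> g \in cube_group ->
    (forall f, kind (fpos f) = 3%N -> g f = f) -> I (t * g)%g.
  move=> [ct xt t3] /cube_group_invariant[cg _ xg] g3.
  split; first exact: confM; first by move=> f; rewrite permM xg xt.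
  by move=> f kf; rewrite permM t3 ?g3.
(* One sticker of each edge cubie: the one now at a place of chirality 24. *)
pose l := [seq f <- enum facelet | chir (s f) == 24].
have mem_l f : (f \in l) = (chir (s f) == 24).
  by rewrite mem_filter mem_enum andbT.
have chir_tau f : f \in l -> chir (tau f) = 24.
  rewrite mem_l => /eqP xsf; rewrite /tau xsf.
  have kf : kind (fpos f) = 2%N by rewrite -(conf_kind cs) edge24.
  by case: (chir_edge kf) => xf; rewrite xf /= ?chir_mate xf.
(* Only two mates could share a target, and by pairing at most one of them is in [l]. *)
have tau_inj : {in l &, injective tau}.
  have mate_l f : f \in l -> mate f \notin l.
    by rewrite !mem_l s_paired => /eqP ->.
  move=> f h fl hl; rewrite /tau; case: ifP => _; case: ifP => _ // eq_fh.
  - by rewrite eq_fh (negPf (mate_l h hl)) in fl.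
  - by rewrite -eq_fh (negPf (mate_l f fl)) in hl.
  exact: inv_inj mateK _ _ eq_fh.
have [| | |g [g_cube Isg gl]] := @place_sequentially _ cube_group tau I s l.
- by rewrite filter_uniq ?enum_uniq.
- by split.
- move=> l1 x t x_l x_l1 l1_l It t_l1 t_x; have [ct xt t3] := It.
  have xtx : chir (t x) = 24 by rewrite xt; apply/eqP; rewrite -mem_l.
  have [g [g_cube gx g3 g_fix]] := edge_swap xtx (chir_tau x x_l) t_x.
  exists g; split; [exact: g_cube|exact: I_mul|exact: gx|] => z z_l1.
  have z_l := l1_l z z_l1.
  have zx : z != x by apply: contraNneq x_l1 => <-.
  apply: g_fix; first exact: chir_tau.
    by rewrite -(t_l1 z z_l1) (inj_eq perm_inj).
  by apply: contra zx => /eqP /tau_inj ->.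
have [ct xt t3] := Isg.
exists g; first exact: g_cube.
move: (s * g)%g ct xt t3 gl {Isg} => t ct xt t3 tl f k1.
have [/eqP k3|k3] := boolP (kind (fpos f) == 3%N); first by rewrite t3.
have k2 : kind (fpos f) = 2%N.
  have chk : all (fun x => kind x.1 \in [:: 1; 2; 3]%N) facelet_seq.
    by vm_compute.
  have := all_facelets chk f; rewrite !inE -/(fpos f).
  by rewrite (negPf k1) (negPf k3) orbF => /eqP.
have ks : kind (fpos (s f)) = 2%N by rewrite conf_kind.
have [xsf|xsf] := chir_edge ks; first by rewrite tl ?mem_l ?xsf.
(* A sticker at chirality -24 is outside [l], but its twin is in [l] and carries it along. *)
have : t (twin f) = tau (twin f).
  by apply: tl; rewrite mem_l conf_twin // chir_twin xsf.
rewrite conf_twin // => /(congr1 twin); rewrite twinK => ->.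
rewrite /tau; case: ifP => _; first by rewrite twinK.
by rewrite mate_twin twinK fnormal_mate.
Qed.

(** Cycles place all centers but two of the up face; in whichever order these two end up, both show
    the right colour, so no parity condition arises. *)
Lemma solve_centers s : is_conf s ->
    (forall f, kind (fpos f) != 1%N -> fnormal (s f) = fnormal f) ->
  exists2 g, g \in cube_group & forall f, fnormal ((s * g)%g f) = fnormal f.
Proof.
move=> cs s_normal.
have [z1 ez1] : {f : facelet | ssval f = (1, 1, 3, e3)}.
  by apply: facelet_of; vm_compute.
have [z2 ez2] : {f : facelet | ssval f = (1, -1%:Z, 3, e3)}.
  by apply: facelet_of; vm_compute.
have k1 : kind (fpos z1) = 1%N by rewrite /fpos ez1.
have k2 : kind (fpos z2) = 1%N by rewrite /fpos ez2.
have z12 : z1 != z2 by rewrite -(inj_eq facelet_inj) ez1 ez2.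
have n12 : fnormal z1 = fnormal z2 by rewrite /fnormal ez1 ez2.
pose I (t : {perm facelet}) := is_conf t /\
  forall f, kind (fpos f) != 1%N -> fnormal (t f) = fnormal f.
pose l := [seq f <- enum facelet |
            [&& kind (fpos f) == 1%N, f != z1 & f != z2]].
have mem_l f : (f \in l) = [&& kind (fpos f) == 1%N, f != z1 & f != z2].
  by rewrite mem_filter mem_enum andbT.
have [| | |g [g_cube [csg sg_normal] gl]] :=
  @place_sequentially _ cube_group id I s l.
- by rewrite filter_uniq ?enum_uniq.
- by split.
- move=> l1 x t + x_l1 l1_l [ct t_normal] t_l1 t_x.
  rewrite mem_l => /and3P[/eqP kx xz1 xz2].
  have ktx : kind (fpos (t x)) = 1%N by rewrite conf_kind.
  (* The third center of the cycle is one of [z1], [z2] other than [t x]; it is not a target, so it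
     may be disturbed. *)
  have [z [kz zx ztx zl]] : exists z,
      [/\ kind (fpos z) = 1%N, x != z, t x != z & z \notin l].
    have [tx1|tx1] := eqVneq (t x) z1; last first.
      by exists z1; rewrite mem_l eqxx /= andbF.
    by exists z2; rewrite tx1 mem_l eqxx /= !andbF.
  have [g [g_cube gx g_fix]] := center_cycle ktx kx kz t_x ztx zx.
  have [cg _ _] := cube_group_invariant g_cube.
  exists g; split; [exact: g_cube| |exact: gx|].
    split; first exact: confM.
    move=> f kf; have tf y : kind (fpos y) = 1%N -> t f != y.
      by move=> ky; apply: contraNneq kf => tf; rewrite -(conf_kind ct) tf ky.
    by rewrite permM g_fix; [exact: t_normal|exact: tf|exact: tf|exact: tf].
  move=> y y_l1; have y_l := l1_l y y_l1.
  have yx : y != x by apply: contraNneq x_l1 => <-.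
  apply: g_fix => //; last by apply: contraNneq zl => <-.
  by rewrite -[y in y != _](t_l1 y y_l1) (inj_eq perm_inj).
exists g; first exact: g_cube.
move: (s * g)%g csg sg_normal gl => t ct t_normal tl f.
have [/eqP kf|kf] := boolP (kind (fpos f) == 1%N); last exact: t_normal.
have [f_l|f_l] := boolP (f \in l); first by rewrite tl.
have tf_l : t f \notin l.
  apply/negP => tf_l; have /perm_inj tff := tl _ tf_l.
  by rewrite tff (negPf f_l) in tf_l.
have z12P h : kind (fpos h) = 1%N -> h \notin l -> fnormal h = fnormal z1.
  move=> kh; rewrite mem_l kh eqxx andTb negb_and !negbK.
  by case/orP => /eqP ->; rewrite ?n12.
by rewrite !z12P // conf_kind.
Qed.

Lemma invariants_solvable s : is_conf s -> twist s = 0 ->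
  (forall f, paired s f) -> solvable_conf s.
Proof.
move=> cs ts ps.
have [g g_cube sg3] := solve_corners cs ts.
have [cg tg xg] := cube_group_invariant g_cube.
have csg : is_conf (s * g)%g by exact: confM.
have [|h h_cube sgh] := solve_edges csg _ sg3.
  by move=> f; rewrite /paired !permM !xg; apply: ps.
have [ch th xh] := cube_group_invariant h_cube.
have [k k_cube sghk] := solve_centers (confM csg ch) sgh.
apply/existsP; exists (g * h * k)%g; rewrite !groupM //=.
apply/forallP=> f; apply/forallP=> f'; apply/implyP=> /eqP ff'.
have normalV x : fnormal ((s * (g * h * k))^-1%g x) = fnormal x.
  by rewrite -[in RHS](permKV (s * (g * h * k))%g x) !mulgA sghk.
by rewrite /shown_colour /sticker_colour /face_of !normalV ff'.
Qed.

(** * Monochromatic configurations *)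

Lemma outward_face_of f : outward (face_of f) = fnormal f.
Proof.
have chk : all (fun x =>
    outward (nth Right faces (index x.2 (map outward faces))) == x.2)
  facelet_seq by vm_compute.
by apply/eqP; have := all_facelets chk f.
Qed.

Lemma sticker_colour_normal f f' :
  sticker_colour f = sticker_colour f' -> fnormal f = fnormal f'.
Proof.
rewrite /sticker_colour -!outward_face_of.
by case: (face_of f); case: (face_of f').
Qed.

Definition normals : seq vec := map outward faces.

Lemma fnormal_normals f : fnormal f \in normals.
Proof.
have chk : all (fun x => x.2 \in normals) facelet_seq by vm_compute.
exact: all_facelets chk f.
Qed.

Lemma card_face f : #|[set x | fnormal x == fnormal f]| = 16%N.
Proof.
have chk : all (fun x => count (fun y => y.2 == x.2) facelet_seq == 16%N)
  facelet_seq by vm_compute.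
by rewrite (card_facelets (fun x => x.2 == _)); apply/eqP/(all_facelets chk f).
Qed.

Section Monochromatic.
Variable m : {perm facelet}.
Hypothesis mono_m : monochromatic_faces m.

Lemma mono_home_normal f f' :
  fnormal (m f) = fnormal (m f') -> fnormal f = fnormal f'.
Proof.
move/eqP; have /forallP/(_ (m f))/forallP/(_ (m f'))/implyP mono := mono_m.
by move/mono/eqP; rewrite /shown_colour !permK; apply: sticker_colour_normal.
Qed.

(* The stickers seen on one face have one colour, and there are as many of them
   as stickers of that colour. *)
Lemma mono_normal f f' :
  fnormal f = fnormal f' -> fnormal (m f) = fnormal (m f').
Proof.
move=> eq_ff'.
have sub : (m^-1)%g @: [set x | fnormal x == fnormal (m f)]
    \subset [set x | fnormal x == fnormal f].
  apply/subsetP => _ /imsetP[y + ->]; rewrite !inE => /eqP ny.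
  by apply/eqP/mono_home_normal; rewrite permKV.
have : f' \in [set x | fnormal x == fnormal f] by rewrite inE eq_ff'.
have /eqP <- : (m^-1)%g @: [set x | fnormal x == fnormal (m f)]
    == [set x | fnormal x == fnormal f].
  rewrite eqEcard sub card_imset ?card_face //; exact: perm_inj.
by case/imsetP => y + ->; rewrite inE permKV => /eqP.
Qed.

End Monochromatic.

(** The corner position where the faces with these three normals meet. *)
Definition corner_at (n n' n'' : vec) : vec :=
  scalev 3 (subv (subv n (oppv n')) (oppv n'')).

Definition corner_normals : seq (vec * vec * vec) :=
  [seq (x.2, (spin_data x).2, (spin_data (spin_data x)).2)
     | x <- facelet_seq & is_ref x].

(* [ns] lists the images of [normals]. *)
Definition relabel (ns : seq vec) (n : vec) : vec := nth n ns (index n normals).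

Definition relabelled_corner (ns : seq vec) (c : vec * vec * vec) :
    facelet_data :=
  let: (n, n', n'') := c in
  (corner_at (relabel ns n) (relabel ns n') (relabel ns n''), relabel ns n).

Definition relabelled_clockwise (ns : seq vec) (c : vec * vec * vec) : bool :=
  let: (n, n', n'') := c in
  dot (cross (relabel ns n) (relabel ns n')) (relabel ns n'') == -1.

Definition relabelled_twist (ns : seq vec) (cs : seq (vec * vec * vec)) :
    'Z_3 :=
  foldr +%R 0 [seq twist_at (relabelled_corner ns c) | c <- cs].

(** All 720 permutations of the normals are tried; those keeping every corner clockwise are the 24
    rotations of the cube. *)
Lemma relabelled_twist0 ns : perm_eq ns normals ->
  all (relabelled_clockwise ns) corner_normals ->
  relabelled_twist ns corner_normals = 0.
Proof.
(* Abstracting over [cs] lets [corner_normals] be evaluated once rather than for each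
   permutation. *)
have chk : (fun cs => all (fun ns => all (relabelled_clockwise ns) cs ==>
    (relabelled_twist ns cs == 0)) (permutations normals)) corner_normals.
  by vm_compute.
rewrite -mem_permutations => ns_perm cw_ns; apply/eqP.
by have /implyP := allP chk _ ns_perm; apply.
Qed.

Lemma fpos_corner f : kind (fpos f) = 3%N ->
  fpos f = corner_at (fnormal f) (fnormal (spin f)) (fnormal (spin (spin f))).
Proof.
have chk : all (fun x => (kind x.1 == 3%N) ==>
    (x.1 == corner_at x.2 (spin_data x).2 (spin_data (spin_data x)).2))
  facelet_seq by vm_compute.
by move=> /eqP/(all_facelets_if chk)/eqP; rewrite -!ssval_spin.
Qed.

(** By [mono_normal], [m] acts on the normals; a corner facelet is determined by the clockwise
    normals of its corner, so [twist m] depends only on this relabelling of normals. *)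
Lemma twist_mono m : is_conf m -> monochromatic_faces m -> twist m = 0.
Proof.
move=> cm mono_m.
(* The default [n] is never taken on [normals], each of which belongs to some facelet. *)
pose image n :=
  if [pick f | fnormal f == n] is Some f then fnormal (m f) else n.
have imageE f : image (fnormal f) = fnormal (m f).
  rewrite /image; case: pickP => [h /eqP|/(_ f)]; last by rewrite eqxx.
  exact: mono_normal.
pose ns := map image normals.
have relabelE (f : facelet) : relabel ns (ssval f).2 = (ssval (m f)).2.
  rewrite -/(fnormal f) /relabel /ns.
  rewrite (nth_map (fnormal f)) ?index_mem ?fnormal_normals //.
  by rewrite nth_index ?fnormal_normals // imageE.
have normalsP n : n \in normals -> exists f, fnormal f = n.
  have chk : all (fun n => has (fun x => x.2 == n) facelet_seq) normals.
    by vm_compute.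
  by move/(allP chk)/has_facelet => [f /eqP]; exists f.
have ns_perm : perm_eq ns normals.
  have uniq_n : uniq normals by vm_compute.
  have uniq_ns : uniq ns.
    rewrite map_inj_in_uniq // => n n' /normalsP[f <-] /normalsP[f' <-].
    by rewrite !imageE => /(mono_home_normal mono_m).
  have sub : {subset ns <= normals}.
    move=> _ /mapP[n /normalsP[f <-] ->].
    by rewrite imageE fnormal_normals.
  apply: uniq_perm => //.
  by have [] := uniq_min_size uniq_ns sub; rewrite ?size_map.
have ref3 (f : facelet) : is_ref (ssval f) -> kind (fpos f) = 3%N.
  by case/andP => /eqP.
rewrite (twist_eval (F := fun x => relabelled_corner ns
    (x.2, (spin_data x).2, (spin_data (spin_data x)).2))).
  transitivity (relabelled_twist ns corner_normals).
    by rewrite /relabelled_twist /corner_normals -map_comp.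
  apply: relabelled_twist0 => //.
  rewrite all_map; apply/allP => x; rewrite mem_filter => /andP[rx x_f].
  have [f fx] := facelet_of x_f; rewrite -fx in rx *.
  have kf := ref3 f rx.
  suff: relabelled_clockwise ns ((ssval f).2, (spin_data (ssval f)).2,
    (spin_data (spin_data (ssval f))).2) by [].
  rewrite -!ssval_spin /relabelled_clockwise !relabelE !conf_spin //.
  have /and3P[_ _ //] : clockwise (m f) (spin (m f)) (spin (spin (m f))).
  by apply: spin_clockwise; rewrite conf_kind.
move=> f /ref3 kf; rewrite /relabelled_corner -!ssval_spin !relabelE.
have := @fpos_corner (m f); rewrite conf_kind // => /(_ kf).
rewrite /fpos /fnormal !conf_spin // => <-.
by case: (ssval (m f)).
Qed.

Lemma kind_mate f : kind (fpos (mate f)) = kind (fpos f).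
Proof.
have chk : all (fun x => kind (mate_data x).1 == kind x.1) facelet_seq.
  by vm_compute.
by have /eqP := all_facelets chk f; rewrite -ssval_mate.
Qed.

Lemma paired_nonedge s f : is_conf s -> kind (fpos f) != 2%N -> paired s f.
Proof.
move=> cs k2; rewrite /paired.
by rewrite !chir_nonedge ?oppr0 // conf_kind // kind_mate.
Qed.

(** [f] and [mate f] share a normal, as do their twins, so the same holds for their images, which
    are mates by [mate_unique]. *)
Lemma paired_mono m f : is_conf m -> monochromatic_faces m -> paired m f.
Proof.
move=> cm mono_m.
have [/eqP k2|k2] := boolP (kind (fpos f) == 2%N); last exact: paired_nonedge.
rewrite /paired -chir_mate; apply/eqP; congr chir.
apply: mate_unique; rewrite ?conf_kind ?kind_mate //.
- rewrite (inj_eq perm_inj); apply/eqP => eq_f.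
  by have := chir_mate f; rewrite -eq_f; case: (chir_edge k2) => ->.
- by apply: mono_normal; rewrite ?fnormal_mate.
rewrite -!conf_twin //; apply: mono_normal => //.
by rewrite -mate_twin fnormal_mate.
Qed.

Lemma solvable_invariants s : is_conf s -> solvable_conf s ->
  twist s = 0 /\ forall f, paired s f.
Proof.
move=> cs /existsP[g /andP[g_cube mono_sg]].
have [cg tg xg] := cube_group_invariant g_cube.
have csg : is_conf (s * g)%g by exact: confM.
split; first by rewrite -(twist_mono csg mono_sg) twistM // tg addr0.
by move=> f; have := paired_mono f csg mono_sg; rewrite /paired !permM !xg.
Qed.

(** * Counting *)

(** Left multiplication by powers of [c] injects each fibre of [v] into every other, so all [p.+2]
    fibres have the same size. *)
Lemma card_shift (gT : finGroupType) (X : {set gT}) (p : nat) (c : gT)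
    (v : gT -> 'I_p.+2) :
    {in X, forall s, (c * s)%g \in X} ->
    {in X, forall s, v (c * s)%g = v s + 1} ->
  #|X| = (p.+2 * #|[set s in X | v s == 0%R]|)%N.
Proof.
move=> Xc vc; pose fib k := [set s in X | v s == k].
have shift i s :
    s \in X -> (c ^+ i * s)%g \in X /\ v (c ^+ i * s)%g = v s + i%:R.
  move=> sX; elim: i => [|i [IHX IHv]]; first by rewrite expg0 mul1g addr0.
  by rewrite expgS -mulgA Xc // vc // IHv -addrA natr1.
have le_fib j k : (#|fib j| <= #|fib k|)%N.
  rewrite -(card_imset (mem (fib j)) (mulgI (c ^+ (k - j)%R)%g)).
  apply/subset_leq_card/subsetP => _ /imsetP[s + ->].
  rewrite !inE => /andP[sX /eqP vs]; have [-> ->] := shift (k - j) s sX.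
  by rewrite vs natr_Zp addrC subrK eqxx.
rewrite -sum1_card (partition_big v predT) //=.
rewrite (eq_bigr (fun=> #|fib 0|)); first by rewrite sum_nat_const card_ord.
move=> k _; rewrite sum1dep_card; apply/eqP.
by rewrite eqn_leq -[[set _ | _]]/(fib k) !le_fib.
Qed.

(** * Equidistribution of the corner twist *)

Definition swap (a b x : facelet_data) : facelet_data :=
  if x == a then b else if x == b then a else x.

Lemma ssval_tperm (f g h : facelet) :
  ssval (tperm f g h) = swap (ssval f) (ssval g) (ssval h).
Proof.
rewrite /swap !(inj_eq facelet_inj).
by case: tpermP => [-> | -> | /eqP/negPf -> /eqP/negPf ->] //;
  rewrite eqxx //; case: eqP => // ->.
Qed.

Lemma card_twist0 :
  #|SConf| = (3 * #|[set s in SConf | twist s == 0%R]|)%N.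
Proof.
have [r er] : {r : facelet | ssval r = corner_b}.
  by apply: facelet_of; vm_compute.
(* The 3-cycle of the facelets of one corner, which agrees with [spin] there: a single corner
   twisted in place. *)
pose c : {perm facelet} := (tperm r (spin r) * tperm r (spin (spin r)))%g.
pose F x := swap corner_b (spin_data (spin_data corner_b))
  (swap corner_b (spin_data corner_b) x).
have cF f : ssval (c f) = F (ssval f).
  by rewrite permM !ssval_tperm !ssval_spin er.
have cc : is_conf c by apply: (conf_by_check cF); vm_compute.
have tc : twist c = 1.
  by rewrite (twist_eval (fun f _ => cF f)); apply/eqP; vm_compute.
apply: (@card_shift _ SConf 1 c twist) => s; rewrite !inE => cs.
  exact: confM.
by rewrite twistM // tc addrC.
Qed.

(** * Equidistribution of the edge flips *)

(** Separates the two edge cubies of a pair, whose coordinates 1 and -1 have opposite signs. *)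
Definition has_coord1 (p : vec) : bool :=
  let: (p1, p2, p3) := p in (1 : int) \in [:: p1; p2; p3].

Definition is_rep (x : facelet_data) : bool :=
  (chirality x == 24) && has_coord1 x.1.

(* One sticker for each of the twelve pairs of equally coloured edge cubies. *)
Definition reps : seq facelet := enum [set f : facelet | is_rep (ssval f)].

Lemma size_reps : size reps = 12%N.
Proof. by rewrite -cardE card_facelets; vm_compute. Qed.

Lemma mem_reps f : (f \in reps) = is_rep (ssval f).
Proof. by rewrite mem_enum inE. Qed.

Lemma paired_mate s f : paired s (mate f) = paired s f.
Proof. by rewrite /paired mateK [RHS]eq_sym eqr_oppLR. Qed.

Lemma paired_twin s f : is_conf s -> paired s (twin f) = paired s f.
Proof.
by move=> cs; rewrite /paired mate_twin !conf_twin // !chir_twin eqr_opp.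
Qed.

(** Every edge facelet reaches a representative through [mate], [twin] or both, and [paired] is
    unchanged by either. *)
Lemma paired_reps s :
  is_conf s -> all (paired s) reps -> forall f, paired s f.
Proof.
move=> cs /allP s_reps f.
have chk : all (fun x => [|| kind x.1 != 2%N, is_rep x, is_rep (mate_data x),
    is_rep (twin_data x) | is_rep (twin_data (mate_data x))]) facelet_seq.
  by vm_compute.
have := all_facelets chk f; rewrite -ssval_mate -!ssval_twin -!mem_reps.
case/orP => [k2|]; first exact: paired_nonedge.
by case/or4P => /s_reps; rewrite ?paired_twin ?paired_mate.
Qed.

Definition flip (f : facelet) : {perm facelet} := tperm f (twin f).

Lemma fpos_flip q f : fpos (flip q f) = fpos f.
Proof. by rewrite /flip; case: tpermP => [->|->|//]; rewrite fpos_twin. Qed.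

Lemma flip_fixed q f :
  kind (fpos q) = 2%N -> kind (fpos f) != 2%N -> flip q f = f.
Proof.
move=> kq kf; rewrite /flip tpermD //; apply: contraNneq kf => <-.
  by rewrite kq.
by rewrite fpos_twin kq.
Qed.

Lemma clockwise_corner f g h : clockwise f g h -> kind (fpos f) = 3%N.
Proof.
have chk : all (fun x => all (fun y => has (cw x y) (cubie x) ==>
    (kind x.1 == 3%N)) (cubie x)) facelet_seq by vm_compute.
move=> cw_fgh; have /and3P[/eqP fg /eqP gh _] := cw_fgh.
have: has (cw (ssval f) (ssval g)) (cubie (ssval f)).
  by apply/hasP; exists (ssval h); rewrite ?(mem_cubie (etrans fg gh)).
by move/(all_cubies_if chk fg)/eqP.
Qed.

Lemma conf_flip q : kind (fpos q) = 2%N -> is_conf (flip q).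
Proof.
move=> kq; apply: conf_intro => [f g|f|f g h cw_fgh]; rewrite ?fpos_flip //.
have kf := clockwise_corner cw_fgh.
have /and3P[/eqP fg /eqP gh _] := cw_fgh.
by rewrite !flip_fixed // -?gh -?fg kf.
Qed.

Lemma twist_flip q : kind (fpos q) = 2%N -> twist (flip q) = 0.
Proof.
move=> kq; rewrite /twist big1 // => f /andP[/eqP kf /eqP tf].
by rewrite flip_fixed // [kind _]kf.
Qed.

Lemma kind_rep q : q \in reps -> kind (fpos q) = 2%N.
Proof.
rewrite mem_reps => /andP[/eqP xq _]; apply/eqP.
by apply: contra_eqT xq => /chir_nonedge; rewrite /chir => ->.
Qed.

Lemma flip_mate_rep q f : q \in reps -> f \in reps -> flip q (mate f) = mate f.
Proof.
have chk : all (fun x => is_rep x ==> ~~ has_coord1 (mate_data x).1)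
    facelet_seq.
  by vm_compute.
rewrite !mem_reps => /andP[_ q1] /(all_facelets_if chk).
rewrite -ssval_mate => f1; rewrite /flip tpermD //.
  by apply: contraNneq f1 => <-.
by apply: contraNneq f1 => <-; rewrite -/(fpos _) fpos_twin.
Qed.

Lemma flip_rep q f : q \in reps -> f \in reps -> f != q -> flip q f = f.
Proof.
rewrite !mem_reps => /andP[/eqP xq _] /andP[/eqP xf _] fq.
rewrite /flip tpermD //; first by rewrite eq_sym.
apply/eqP => eq_f; have := chir_twin q.
by rewrite eq_f /chir xf xq.
Qed.

Lemma paired_flip_other s q f : q \in reps -> f \in reps -> f != q ->
  paired (flip q * s)%g f = paired s f.
Proof.
by move=> qr fr fq; rewrite /paired !permM flip_mate_rep // flip_rep.
Qed.

(** [flip q] moves [q] to its twin but fixes its mate, so exactly one of the two chiralities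
    compared changes sign. *)
Lemma paired_flip s q : is_conf s -> q \in reps ->
  paired (flip q * s)%g q = ~~ paired s q.
Proof.
move=> cs qr; rewrite /paired !permM flip_mate_rep // /flip tpermL.
rewrite conf_twin // chir_twin opprK.
have ks : kind (fpos (s q)) = 2%N by rewrite conf_kind ?kind_rep.
have ksm : kind (fpos (s (mate q))) = 2%N.
  by rewrite conf_kind // kind_mate kind_rep.
by case: (chir_edge ks) => ->; case: (chir_edge ksm) => ->.
Qed.

Definition paired_confs (l : seq facelet) : {set {perm facelet}} :=
  [set s in [set s in SConf | twist s == 0] | all (paired s) l].

(** Each further representative halves the count: flipping its cubie first toggles its own pairing
    and preserves the twist and the pairing of the other representatives. *)
Lemma card_paired_confs l : uniq l -> {subset l <= reps} ->
  #|paired_confs [::]| = (2 ^ size l * #|paired_confs l|)%N.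
Proof.
elim: l => [|q l IHl] /=; first by rewrite mul1n.
move=> /andP[q_l uniq_l] l_reps.
have q_rep : q \in reps by apply: l_reps; rewrite mem_head.
have l_reps' : {subset l <= reps}.
  by move=> f f_l; apply: l_reps; rewrite inE f_l orbT.
rewrite (IHl uniq_l l_reps') expnSr -mulnA; congr muln.
(* The value 0 means paired, and toggling is addition of 1 modulo 2, as [card_shift] expects. *)
pose v (s : {perm facelet}) : 'I_2 := (~~ paired s q)%:R.
have kq := kind_rep q_rep.
have -> : paired_confs (q :: l) = [set s in paired_confs l | v s == 0].
  apply/setP => s; rewrite /paired_confs [in LHS]in_set [in RHS]in_set.
  rewrite [in RHS]in_set /= /v.
  by case: (paired s q); rewrite ?andbF ?andbT.
apply: (@card_shift _ (paired_confs l) 0 (flip q) v).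
  move=> s; rewrite !inE => /andP[/andP[cs /eqP ts] /allP s_l].
  rewrite confM ?conf_flip // twistM ?conf_flip // twist_flip // ts addr0 eqxx.
  apply/allP => f f_l; have fq : f != q by apply: contraNneq q_l => <-.
  by rewrite paired_flip_other ?s_l //; apply: l_reps'.
move=> s; rewrite !inE => /andP[/andP[cs _] _]; rewrite /v paired_flip //.
by case: (paired s q); apply/val_inj.
Qed.

Theorem corollary3p2 :
  uniform_prob SConf solvable_conf = 1 / (2 ^+ 12 * 3).
Proof.
have solvable_eq : [set s in SConf | solvable_conf s] = paired_confs reps.
  apply/setP => s; rewrite !inE; have [cs|//] := boolP (is_conf s).
  apply/idP/andP => [/(solvable_invariants cs)[-> s_paired]|[/eqP ts s_reps]].
    by split; last by apply/allP.
  by apply: invariants_solvable => //; apply: paired_reps.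
have card_conf : #|SConf| = (3 * (2 ^ 12 * #|paired_confs reps|))%N.
  rewrite card_twist0 -size_reps -card_paired_confs ?enum_uniq //.
  by congr muln; apply: eq_card => s; rewrite !inE andbT.
have card_gt0 : (0 < #|SConf|)%N.
  by apply/card_gt0P; exists 1%g; rewrite inE conf1.
(* The identity is a configuration, so the common count is nonzero and cancels from the quotient. *)
have N0 : (#|paired_confs reps|%:R : rat) != 0.
  rewrite Num.Theory.pnatr_eq0; apply: contraTneq card_gt0.
  by rewrite card_conf => ->; rewrite !muln0.
rewrite /uniform_prob solvable_eq card_conf natrM natrM natrX.
by rewrite mulrA invfM mulrCA divff // mulr1 mul1r [3 * _]mulrC.
Qed.
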